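(* Let $\mathcal{S}$ be an anti-negative semifield, let $n$ be a positive integer, and let $T:M_n(\mathcal{S})\to M_n(\mathcal{S})$ be a bijective $\mathcal{S}$-linear transformation. Then the following are equivalent: (i) $T$ preserves $\mathcal{D}$; (ii) $T$ preserves $\mathcal{J}$; (iii) $T$ preserves $\le_{\mathcal{J}}$; (iv) there exist invertible (monomial) matrices $P,Q\in M_n(\mathcal{S})$ such that either $T(X)=PXQ$ for all $X\in M_n(\mathcal{S})$, or $T(X)=PX^TQ$ for all $X\in M_n(\mathcal{S})$, where $X^T$ denotes the transpose of $X$.
   Context: A semiring is a set $\mathcal{S}$ with addition and multiplication such that $\mathcal{S}$ is a commutative monoid under addition with identity $0_{\mathcal{S}}$, a semigroup under multiplication, multiplication distributes over addition on both sides, and $s0_{\mathcal{S}}=0_{\mathcal{S}}s=0_{\mathcal{S}}$ for all $s$. It is a semifield if $\mathcal{S}\setminus\{0_{\mathcal{S}}\}$ is an abelian group under multiplication (with identity $1_{\mathcal{S}}$). It is anti-negative if $a+b=0_{\mathcal{S}}$ implies $a=b=0_{\mathcal{S}}$. $M_n(\mathcal{S})$ is the set of $n\times n$ matrices over $\mathcal{S}$, viewed as a monoid under matrix multiplication and as an $\mathcal{S}$-module entrywise. $\mathcal{S}$-linear means additive and compatible with scalar multiplication. In the monoid $\mathcal{M}=M_n(\mathcal{S})$: $a\le_{\mathcal{J}} b$ iff there are $s,t\in\mathcal{M}$ with $a=sbt$; $a\,\mathcal{J}\,b$ iff $a\le_{\mathcal{J}}b$ and $b\le_{\mathcal{J}}a$.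 Also $a\,\mathcal{R}\,b$ iff $a=bs$ and $b=at$ for some $s,t\in\mathcal{M}$; $a\,\mathcal{L}\,b$ iff $a=sb$ and $b=ta$ for some $s,t\in\mathcal{M}$; $a\,\mathcal{D}\,b$ iff there is $c\in\mathcal{M}$ with $a\,\mathcal{R}\,c$ and $c\,\mathcal{L}\,b$. $T$ preserves a relation $\mathcal{P}$ if $A\,\mathcal{P}\,B$ implies $T(A)\,\mathcal{P}\,T(B)$ for all $A,B\in M_n(\mathcal{S})$. A monomial matrix is one with exactly one non-zero entry in each row and in each column; over an anti-negative semifield the invertible matrices in $M_n(\mathcal{S})$ are precisely the monomial ones. *)

(* Defs.v *)
From mathcomp Require Import all_boot all_order all_algebra.

Set Implicit Arguments.
Unset Strict Implicit.
Unset Printing Implicit Defensive.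

Import GRing.Theory.
Local Open Scope ring_scope.

(* [comNzSemiRingType] already provides commutativity and [1 != 0]. That the
   nonzero elements are closed under multiplication and inversion follows from
   the existence of inverses. *)
Definition is_semifield (S : comNzSemiRingType) : Prop :=
  forall x : S, x != 0 -> exists y : S, x * y = 1.

Definition antinegative (S : comNzSemiRingType) : Prop :=
  forall a b : S, a + b = 0 -> a = 0 /\ b = 0.

Section Matrices.
Variables (S : comNzSemiRingType) (n : nat).
Implicit Types A B P : 'M[S]_n.

Definition green_leJ A B : Prop := exists X Y : 'M[S]_n, A = X *m B *m Y.

Definition green_J A B : Prop := green_leJ A B /\ green_leJ B A.

Definition green_R A B : Prop :=
  (exists X : 'M[S]_n, A = B *m X) /\ (exists Y : 'M[S]_n, B = A *m Y).

Definition green_L A B : Prop :=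
  (exists X : 'M[S]_n, A = X *m B) /\ (exists Y : 'M[S]_n, B = Y *m A).

Definition green_D A B : Prop := exists C : 'M[S]_n, green_R A C /\ green_L C B.

Definition preserves (T : 'M[S]_n -> 'M[S]_n)
    (rel : 'M[S]_n -> 'M[S]_n -> Prop) : Prop :=
  forall A B, rel A B -> rel (T A) (T B).

(* [unitmx] is only available over commutative rings with units. *)
Definition invertible_mx P : Prop :=
  exists P' : 'M[S]_n, P *m P' = 1%:M /\ P' *m P = 1%:M.

Definition monomial_mx P : Prop :=
  (forall i, exists! j, P i j != 0) /\ (forall j, exists! i, P i j != 0).

End Matrices.

(* Main.v *)
Require Import Defs.
From mathcomp Require Import all_boot all_order all_algebra.

(** Write a dyad for a matrix [u *m v], a column times a row.  Any two nonzero
    dyads are D-related ([dyads_green_D]), and everything J-below a dyad is a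
    dyad ([leJ_dyad]).  Since D implies J, which implies the J-order, each of the
    three preservation properties yields the single weak property
      [green_D A B -> green_leJ (T A) (T B)],
    and comparing any nonzero dyad with a matrix unit shows that such a [T] maps
    dyads to dyads ([dyad_image]), provided that [T] maps some matrix unit to a
    dyad.

    That proviso holds because of antinegativity: cancellation is impossible, so
    a bijective linear map sends each matrix unit to a nonzero
    multiple of a matrix unit ([linear_bij_monomial]).  Thus [T] permutes the
    cells of the n x n grid by some [s], up to nonzero weights [c].

    The support of a dyad is a rectangle.  The sum of two matrix units on a
    common line is a dyad, so its image, which has a two-cell support, lies on a
    line too: [s] preserves collinearity.  Such a permutation of the grid permutes
    rows and columns separately, possibly after a transposition
    ([collinear_perm_grid]).  Finally the image of the all-ones dyad is a dyad,
    which says exactly that the weights factor as a function of the row times a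
    function of the column; these two functions are the nonzero entries of the
    monomial matrices [P] and [Q] ([weighted_grid_perm_mulmx]).

    Conversely, multiplication by invertible matrices preserves left and right
    divisibility, and transposition exchanges them; the latter preserves D
    because L and R commute ([green_LR_D]). *)

Set Implicit Arguments.
Unset Strict Implicit.
Unset Printing Implicit Defensive.

Import GRing.Theory.
Local Open Scope ring_scope.

(** * Antinegative semifields *)

Section Semifield.
Variable S : comNzSemiRingType.

Lemma semifield_mulf_neq0 (x y : S) :
  is_semifield S -> x != 0 -> y != 0 -> x * y != 0.
Proof.
move=> sfS /sfS[x' xx'] nz_y; apply: contra_neq nz_y => xy0.
by rewrite -[y]mul1r -xx' mulrAC xy0 mul0r.
Qed.

Lemma antinegative_sum_eq0 (I : finType) (F : I -> S) :
  antinegative S -> \sum_i F i = 0 -> forall i, F i = 0.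
Proof. by move=> anS sumF0 i; move: sumF0; rewrite (bigD1 i) //= => /anS[]. Qed.

Lemma sum_neq0 (I : finType) (F : I -> S) :
  \sum_i F i != 0 -> exists i, F i != 0.
Proof.
move=> nz; apply/existsP; apply: contraNT nz; rewrite negb_exists.
by move=> /forallP F0; rewrite big1 // => i _; apply/eqP; rewrite -[_ == _]negbK.
Qed.

End Semifield.

(** * Bijective linear maps are monomial *)

Section MonomialMap.
Variables (S : comNzSemiRingType) (n : nat) (T : {linear 'M[S]_n -> 'M[S]_n}).
Hypotheses (sfS : is_semifield S) (anS : antinegative S) (bijT : bijective T).

Lemma linear_mx_sum (X : 'M[S]_n) p q :
  T X p q = \sum_(w : 'I_n * 'I_n) X w.1 w.2 * T (delta_mx w.1 w.2) p q.
Proof.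
rewrite {1}[X]matrix_sum_delta pair_bigA linear_sum summxE.
by apply: eq_bigr => w _; rewrite linearZ mxE.
Qed.

(** Expand the preimage of a matrix unit into matrix units [w].  The images of
    the [w] that occur cannot cancel, so none of them has an entry outside of
    the given cell. *)
Lemma linear_bij_unit (z : 'I_n * 'I_n) : exists w : 'I_n * 'I_n,
  forall p, (T (delta_mx w.1 w.2) p.1 p.2 != 0) = (p == z).
Proof.
case: bijT => T' _ TK.
pose A := T' (delta_mx z.1 z.2).
have TA p q : T A p q = ((p, q) == z)%:R.
  by rewrite TK mxE -pair_eqE; case: (z).
have [w nz_w] : exists w : 'I_n * 'I_n,
    A w.1 w.2 * T (delta_mx w.1 w.2) z.1 z.2 != 0.
  by apply: sum_neq0; rewrite -linear_mx_sum TA -surjective_pairing eqxx oner_eq0.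
exists w => p; case: (eqVneq p z) => [-> | neq_pz].
  by apply: contra_neq nz_w => ->; rewrite mulr0.
have nz_A : A w.1 w.2 != 0 by apply: contra_neq nz_w => ->; rewrite mul0r.
apply: contraFF (erefl false) => nz_p.
have /eqP[] := semifield_mulf_neq0 sfS nz_A nz_p.
apply: (@antinegative_sum_eq0 _ _
  (fun w => A w.1 w.2 * T (delta_mx w.1 w.2) p.1 p.2) anS).
by rewrite -linear_mx_sum TA -surjective_pairing (negbTE neq_pz).
Qed.

Lemma linear_bij_monomial :
  exists (s : 'I_n * 'I_n -> 'I_n * 'I_n) (c : 'I_n * 'I_n -> S),
    [/\ injective s, forall w, c w != 0
      & forall X w, T X (s w).1 (s w).2 = c w * X w.1 w.2].
Proof.
have [t tP] := fin_all_exists linear_bij_unit.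
have inj_t : injective t.
  by move=> z z' eq_t; apply/eqP; rewrite -tP -eq_t tP.
have sP w p : (T (delta_mx w.1 w.2) p.1 p.2 != 0) = (p == invF inj_t w).
  by rewrite -{1 2}[w](f_invF inj_t) tP.
exists (invF inj_t), (fun w =>
  T (delta_mx w.1 w.2) (invF inj_t w).1 (invF inj_t w).2).
split=> [|w|X w]; first exact: can_inj (f_invF inj_t).
  by rewrite sP.
rewrite linear_mx_sum (bigD1 w) //= big1 ?addr0 1?mulrC // => w' neq_w.
suff /eqP-> : T (delta_mx w'.1 w'.2) (invF inj_t w).1 (invF inj_t w).2 == 0.
  by rewrite mulr0.
rewrite -[_ == _]negbK sP (inj_eq (can_inj (f_invF inj_t))).
by rewrite eq_sym.
Qed.

End MonomialMap.

(** * Collinearity-preserving permutations of the grid *)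

Section Grid.

Definition collinear (I : eqType) (a b : I * I) := (a.1 == b.1) || (a.2 == b.2).

(** Two distinct cells on a line determine that line, so a pairwise collinear
    family cannot turn a corner. *)
Lemma collinear_family (I : eqType) (J : finType) (h : J -> I * I) :
  (forall j k, collinear (h j) (h k)) ->
  (forall j k, (h j).1 = (h k).1) \/ (forall j k, (h j).2 = (h k).2).
Proof.
move=> colh; case: (boolP [forall j, forall k, (h j).1 == (h k).1]).
  by move=> /forallP all_eq; left=> j k; apply/eqP/(forallP (all_eq j)).
rewrite negb_forall => /existsP[j]; rewrite negb_forall => /existsP[k neq1].
right; suff eqj l : (h l).2 = (h j).2 by move=> l m; rewrite !eqj.
have := colh j k; rewrite /collinear (negbTE neq1) /= => /eqP eq2.
have := colh l j; rewrite /collinear; case/orP=> /eqP // eq_lj.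
have := colh l k; rewrite /collinear eq_lj (negbTE neq1) eq2 /=.
by move/eqP.
Qed.

Variables (I : finType) (s : I * I -> I * I).
Hypothesis inj_s : injective s.
Hypothesis col_s : forall a b, collinear a b -> collinear (s a) (s b).

(** Each row fills the whole row onto which it is mapped, so distinct rows have
    distinct images; then two cells of a column land in different rows, and
    being collinear they must share a column. *)
Lemma rows_to_rows_grid (i0 : I) :
  (forall i j k, (s (i, j)).1 = (s (i, k)).1) ->
  exists f g : I -> I,
    [/\ injective f, injective g & forall i j, s (i, j) = (f i, g j)].
Proof.
move=> row_s; pose f i := (s (i, i0)).1; pose g j := (s (i0, j)).2.
have inj2 i : injective (fun j => (s (i, j)).2).
  move=> j k eq2; suff /inj_s[] : s (i, j) = s (i, k) by [].
  by apply/eqP; rewrite -pair_eqE /pair_eq /= eq2 (row_s i j k) !eqxx.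
have inj_f : injective f.
  move=> i i' eq_f; pose k := invF (inj2 i) (s (i', i0)).2.
  suff /inj_s[] : s (i, k) = s (i', i0) by [].
  apply/eqP; rewrite -pair_eqE /pair_eq /= (row_s i k i0) -/(f i) eq_f eqxx /=.
  by rewrite (f_invF (inj2 i)).
exists f, g; split=> // [|i j]; first exact: inj2.
rewrite [s _]surjective_pairing (row_s i j i0) -/(f i); congr pair.
case: (eqVneq i i0) => [-> // | neq_i].
have := col_s (a := (i, j)) (b := (i0, j)); rewrite /collinear /= eqxx orbT.
move/(_ isT)/orP=> [|/eqP //].
by rewrite (row_s i j i0) (row_s i0 j i0) (inj_eq inj_f) (negbTE neq_i).
Qed.

(** A row sent into a row and a row sent into a column have images that meet,
    since both are full lines; so all rows are sent to lines of the same kind. *)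
Lemma rows_to_parallel_lines :
  (forall i j k, (s (i, j)).1 = (s (i, k)).1) \/
  (forall i j k, (s (i, j)).2 = (s (i, k)).2).
Proof.
have line i : (forall j k, (s (i, j)).1 = (s (i, k)).1) \/
              (forall j k, (s (i, j)).2 = (s (i, k)).2).
  apply: (collinear_family (h := fun j => s (i, j))) => j k.
  by apply: col_s; rewrite /collinear eqxx.
case: (boolP [forall i, forall j, forall k, (s (i, j)).1 == (s (i, k)).1]).
  move=> /forallP row_s; left=> i j k; apply/eqP.
  by move: (row_s i) => /forallP/(_ j)/forallP/(_ k).
rewrite negb_forall => /existsP[i' not_row]; right=> i.
have col_i' : forall j k, (s (i', j)).2 = (s (i', k)).2.
  case: (line i') => // row_i'; case/negP: not_row.
  by apply/forallP=> j; apply/forallP=> k; apply/eqP.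
case: (line i) => // row_i.
have inj2 : injective (fun j => (s (i, j)).2).
  move=> j k eq2; suff /inj_s[] : s (i, j) = s (i, k) by [].
  by apply/eqP; rewrite -pair_eqE /pair_eq /= eq2 (row_i j k) !eqxx.
have inj1 : injective (fun j => (s (i', j)).1).
  move=> j k eq1; suff /inj_s[] : s (i', j) = s (i', k) by [].
  by apply/eqP; rewrite -pair_eqE /pair_eq /= eq1 (col_i' j k) !eqxx.
move=> j0 k0; pose j := invF inj2 (s (i', j0)).2.
pose k := invF inj1 (s (i, j)).1.
suff /inj_s[eq_i _] : s (i', k) = s (i, j) by rewrite -eq_i; apply: col_i'.
apply/eqP; rewrite -pair_eqE /pair_eq /= (f_invF inj1) eqxx /=.
by rewrite (col_i' k j0) (f_invF inj2).
Qed.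

End Grid.

Lemma collinear_perm_grid (I : finType) (i0 : I) (s : I * I -> I * I) :
  injective s -> (forall a b, collinear a b -> collinear (s a) (s b)) ->
  exists f g : I -> I, [/\ injective f, injective g
    & (forall i j, s (i, j) = (f i, g j)) \/
      (forall i j, s (i, j) = (g j, f i))].
Proof.
move=> inj_s col_s; case: (rows_to_parallel_lines inj_s col_s) => line_s.
  have [f [g [inj_f inj_g sE]]] := rows_to_rows_grid inj_s col_s i0 line_s.
  by exists f, g; split=> //; left.
pose s' a := ((s a).2, (s a).1).
have inj_s' : injective s'.
  by move=> a b [eq2 eq1]; apply: inj_s; case: (s a) (s b) eq1 eq2 => ? ? [? ?] /= -> ->.
have col_s' a b : collinear a b -> collinear (s' a) (s' b).
  by move=> /col_s; rewrite /collinear orbC.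
have [f [g [inj_f inj_g sE]]] := rows_to_rows_grid inj_s' col_s' i0 line_s.
exists f, g; split=> //; right=> i j.
by have [<- <-] := sE i j; rewrite -surjective_pairing.
Qed.

(** * Monomial matrices *)

Section Monomial.
Variables (S : comNzSemiRingType) (n : nat).
Implicit Types (f : 'I_n -> 'I_n) (a : 'I_n -> S).

Definition scaled_perm_mx f a : 'M[S]_n := \matrix_(p, k) (a k *+ (p == f k)).

Lemma scaled_perm_mulmx f a m (X : 'M[S]_(n, m)) i j : injective f ->
  (scaled_perm_mx f a *m X) (f i) j = a i * X i j.
Proof.
move=> inj_f; rewrite mxE (bigD1 i) //= big1 ?addr0 => [|k neq_k].
  by rewrite mxE eqxx.
by rewrite mxE (inj_eq inj_f) eq_sym (negbTE neq_k) mul0r.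
Qed.

Lemma scaled_perm_invertible f a : is_semifield S -> injective f ->
  (forall i, a i != 0) -> invertible_mx (scaled_perm_mx f a).
Proof.
move=> sfS inj_f nz_a.
have [b ab1] := fin_all_exists (fun i => sfS _ (nz_a i)).
exists (scaled_perm_mx f b)^T; split; apply/matrixP=> p q.
  rewrite -(f_invF inj_f p) scaled_perm_mulmx // !mxE eq_sym.
  by case: eqP => _; rewrite ?ab1 ?mulr0.
rewrite mxE (bigD1 (f p)) //= big1 ?addr0 => [|k neq_k].
  rewrite !mxE eqxx (inj_eq inj_f); case: eqVneq => [<-|_]; last exact: mulr0.
  by rewrite mulrC ab1.
by rewrite !mxE (negbTE neq_k) mul0r.
Qed.

Lemma scaled_perm_monomial f a : injective f ->
  (forall i, a i != 0) -> monomial_mx (scaled_perm_mx f a).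
Proof.
move=> inj_f nz_a.
have nzE p k : (scaled_perm_mx f a p k != 0) = (p == f k).
  by rewrite mxE; case: (p == f k); rewrite ?nz_a ?eqxx.
split=> [p | k]; last by exists (f k); split=> [|p]; rewrite nzE // => /eqP->.
exists (invF inj_f p); split=> [|k]; rewrite nzE; first by rewrite f_invF.
by move/eqP->; rewrite invF_f.
Qed.

Lemma tr_invertible (P : 'M[S]_n) : invertible_mx P -> invertible_mx P^T.
Proof.
by case=> P' [PP' P'P]; exists P'^T; rewrite -!trmx_mul PP' P'P trmx1.
Qed.

Lemma tr_monomial (P : 'M[S]_n) : monomial_mx P -> monomial_mx P^T.
Proof.
case=> rowP colP; split=> i; [have [j [nz uniq_j]] := colP i
  | have [j [nz uniq_j]] := rowP i]; exists j; split; rewrite ?mxE // => k;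
  by rewrite mxE; apply: uniq_j.
Qed.

(** The all-ones matrix is sent to the matrix of weights, up to the permutations
    [f] and [g]; when that is a dyad [u *m v] the weights split as
    [u (f i) * v (g j)]. *)
Lemma weighted_grid_perm_mulmx (F : 'M[S]_n -> 'M[S]_n) f g
    (c : 'I_n -> 'I_n -> S) (u : 'cV_n) (v : 'rV_n) :
  is_semifield S -> (0 < n)%N -> injective f -> injective g ->
  (forall i j, c i j != 0) ->
  (forall X i j, F X (f i) (g j) = c i j * X i j) ->
  F (const_mx 1) = u *m v ->
  exists P Q : 'M[S]_n,
    [/\ invertible_mx P /\ monomial_mx P,
        invertible_mx Q /\ monomial_mx Q
      & forall X : 'M[S]_n, F X = P *m X *m Q].
Proof.
move=> sfS n_gt0 inj_f inj_g nz_c FE F1.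
have cE i j : c i j = u (f i) 0 * v 0 (g j).
  by have := FE (const_mx 1) i j; rewrite F1 !mxE big_ord1 mulr1.
have nz_u i : u (f i) 0 != 0.
  apply: contra_neq (nz_c i (Ordinal n_gt0)) => u0.
  by rewrite cE u0 mul0r.
have nz_v j : v 0 (g j) != 0.
  apply: contra_neq (nz_c (Ordinal n_gt0) j) => v0.
  by rewrite cE v0 mulr0.
exists (scaled_perm_mx f (fun i => u (f i) 0)).
exists (scaled_perm_mx g (fun j => v 0 (g j)))^T.
split; first by split; [apply: scaled_perm_invertible | apply: scaled_perm_monomial].
  by split; [apply/tr_invertible/scaled_perm_invertible
            | apply/tr_monomial/scaled_perm_monomial].
move=> X; apply/matrixP=> p q.
rewrite -(f_invF inj_f p) -(f_invF inj_g q); set i := invF _ p; set j := invF _ q.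
rewrite FE cE -mulmxA scaled_perm_mulmx // -mulrA; congr (_ * _).
rewrite -[X *m _]trmxK trmx_mul trmxK mxE scaled_perm_mulmx //.
by rewrite mxE.
Qed.

End Monomial.

(** * Green's relations and dyads *)

Section Green.
Variables (S : comNzSemiRingType) (n : nat).
Implicit Types A B C P Q : 'M[S]_n.

Lemma green_D_J A B : green_D A B -> green_J A B.
Proof.
case=> C [[[X AE] [Y CA]] [[Z CB] [W BC]]]; split.
  by exists Z, X; rewrite AE CB.
by exists W, Y; rewrite BC CA mulmxA.
Qed.

(** L and R commute because one multiplies on the left and the other on the
    right: the multiplier [W] that leads from [C] to [B] also applies to [A], and
    [A *m W] then closes the square. *)
Lemma green_LR_D A B C : green_L A C -> green_R C B -> green_D A B.
Proof.
case=> [[X AE] [Y CA]] [[Z CB] [W BC]]; exists (A *m W); split; split.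
- by exists Z; rewrite {1}AE CB BC AE !mulmxA.
- by exists W.
- by exists X; rewrite BC AE !mulmxA.
- by exists Y; rewrite BC {1}CA !mulmxA.
Qed.

Lemma green_R_tr A B : green_R A B -> green_L A^T B^T.
Proof.
by case=> [[X ->] [Y BE]]; split; [exists X^T | exists Y^T];
  rewrite -trmx_mul -?BE.
Qed.

Lemma green_L_tr A B : green_L A B -> green_R A^T B^T.
Proof.
by case=> [[X ->] [Y BE]]; split; [exists X^T | exists Y^T];
  rewrite -trmx_mul -?BE.
Qed.

Lemma green_D_tr A B : green_D A B -> green_D A^T B^T.
Proof.
by case=> C [/green_R_tr RAC /green_L_tr LCB]; apply: green_LR_D RAC LCB.
Qed.

Lemma green_D_invertible P Q A B : invertible_mx P -> invertible_mx Q ->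
  green_D A B -> green_D (P *m A *m Q) (P *m B *m Q).
Proof.
move=> [P' [_ P'P]] [Q' [QQ' _]] [C [[[X AE] [Y CE]] [[Z CZ] [W BE]]]].
have cancelP M N : M *m P' *m (P *m N) = M *m N :> 'M[S]_n.
  by rewrite -mulmxA (mulmxA P') P'P mul1mx.
have cancelQ M N : M *m Q *m (Q' *m N) = M *m N :> 'M[S]_n.
  by rewrite -mulmxA (mulmxA Q) QQ' mul1mx.
exists (P *m C *m Q); split; split.
- by exists (Q' *m (X *m Q)); rewrite cancelQ AE !mulmxA.
- by exists (Q' *m (Y *m Q)); rewrite cancelQ {1}CE !mulmxA.
- by exists (P *m Z *m P'); rewrite -(mulmxA P B) cancelP CZ !mulmxA.
- by exists (P *m W *m P'); rewrite -(mulmxA P C) cancelP {1}BE !mulmxA.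
Qed.

Definition dyad A := exists (u : 'cV[S]_n) (v : 'rV[S]_n), A = u *m v.

Lemma leJ_dyad A B : green_leJ A B -> dyad B -> dyad A.
Proof.
by case=> [X [Y ->]] [u [v ->]]; exists (X *m u), (v *m Y); rewrite !mulmxA.
Qed.

Lemma delta_dyad i j : dyad (delta_mx i j).
Proof. by exists (delta_mx i 0), (delta_mx 0 j); rewrite mul_delta_mx. Qed.

Lemma scale_dyad c A : dyad A -> dyad (c *: A).
Proof. by case=> [u [v ->]]; exists (c *: u), v; rewrite -scalemxAl. Qed.

Lemma dyad_support A p q p' q' : is_semifield S -> dyad A ->
  A p q != 0 -> A p' q' != 0 -> A p q' != 0.
Proof.
move=> sfS [u [v ->]]; rewrite !mxE !big_ord1 => nz nz'.
apply: semifield_mulf_neq0 => //.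
  by apply: contra_neq nz => ->; rewrite mul0r.
by apply: contra_neq nz' => ->; rewrite mulr0.
Qed.

Lemma semifield_col_linv (u : 'cV[S]_n) i : is_semifield S -> u i 0 != 0 ->
  exists x : 'rV[S]_n, x *m u = 1%:M.
Proof.
move=> sfS /sfS[y uy1]; exists (y *: delta_mx 0 i).
by rewrite -scalemxAl -rowE; apply/matrixP=> j k; rewrite !ord1 !mxE mulrC uy1.
Qed.

Lemma semifield_row_rinv (v : 'rV[S]_n) j : is_semifield S -> v 0 j != 0 ->
  exists y : 'cV[S]_n, v *m y = 1%:M.
Proof.
move=> sfS nz_v; have [|x xv1] := @semifield_col_linv v^T j sfS.
  by rewrite mxE.
by exists x^T; apply: trmx_inj; rewrite trmx_mul trmxK xv1 trmx1.
Qed.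

(** A nonzero row has a right inverse and a nonzero column a left one, so the
    factors of a nonzero dyad can be exchanged one at a time, via [u *m v']. *)
Lemma dyads_green_D A B i j k l : is_semifield S -> dyad A -> dyad B ->
  A i j != 0 -> B k l != 0 -> green_D A B.
Proof.
move=> sfS [u [v ->]] [u' [v' ->]]; rewrite !mxE !big_ord1 => nzA nzB.
have [|y vy] := @semifield_row_rinv v j sfS.
  by apply: contra_neq nzA => ->; rewrite mulr0.
have [|y' vy'] := @semifield_row_rinv v' l sfS.
  by apply: contra_neq nzB => ->; rewrite mulr0.
have [|x xu] := @semifield_col_linv u i sfS.
  by apply: contra_neq nzA => ->; rewrite mul0r.
have [|x' xu'] := @semifield_col_linv u' k sfS.
  by apply: contra_neq nzB => ->; rewrite mul0r.
exists (u *m v'); split; split.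
- by exists (y' *m v); rewrite mulmxA -(mulmxA u) vy' mulmx1.
- by exists (y *m v'); rewrite mulmxA -(mulmxA u) vy mulmx1.
- by exists (u *m x'); rewrite mulmxA -(mulmxA u x') xu' mulmx1.
- by exists (u' *m x); rewrite mulmxA -(mulmxA u' x) xu mulmx1.
Qed.

Lemma dyad_image (T : 'M[S]_n -> 'M[S]_n) A E i j k l :
  is_semifield S -> (forall A B, green_D A B -> green_leJ (T A) (T B)) ->
  dyad A -> A i j != 0 -> dyad E -> E k l != 0 -> dyad (T E) -> dyad (T A).
Proof.
move=> sfS DT dA nzA dE nzE; apply: leJ_dyad; apply: DT.
exact: (dyads_green_D sfS dA dE nzA nzE).
Qed.

End Green.

(** * Linear maps that weakly preserve D *)

Section Preserver.
Variables (S : comNzSemiRingType) (n : nat) (T : {linear 'M[S]_n -> 'M[S]_n}).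
Hypotheses (sfS : is_semifield S) (anS : antinegative S).
Hypotheses (n_gt0 : (0 < n)%N) (bijT : bijective T).

(** The hypothesis is implied by preservation of any of D, J and the J-order, so
    the three cases need only one argument. *)
Lemma weak_green_preserver :
  (forall A B, green_D A B -> green_leJ (T A) (T B)) ->
  exists P Q : 'M[S]_n,
    [/\ invertible_mx P /\ monomial_mx P,
        invertible_mx Q /\ monomial_mx Q
      & (forall X : 'M[S]_n, T X = P *m X *m Q) \/
        (forall X : 'M[S]_n, T X = P *m X^T *m Q)].
Proof.
move=> DT; have [s [c [inj_s nz_c TE]]] := linear_bij_monomial sfS anS bijT.
pose o := Ordinal n_gt0.
have Tdelta w : T (delta_mx w.1 w.2) = c w *: delta_mx (s w).1 (s w).2.
  apply/matrixP=> p q; pose z := invF inj_s (p, q).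
  have sz : s z = (p, q) by rewrite f_invF.
  have := TE (delta_mx w.1 w.2) z; rewrite sz /= => ->; rewrite !mxE.
  have -> : (p == (s w).1) && (q == (s w).2) = (z == w).
    by rewrite -(inj_eq inj_s) sz.
  have -> : (z.1 == w.1) && (z.2 == w.2) = (z == w) by [].
  by case: eqP => [->|_]; rewrite ?mulr0.
have dyadT A i j : dyad A -> A i j != 0 -> dyad (T A).
  move=> dA nzA; apply: (dyad_image (k := o) (l := o) sfS DT dA nzA (delta_dyad S o o)).
    by rewrite mxE !eqxx oner_eq0.
  by rewrite (Tdelta (o, o)); apply/scale_dyad/delta_dyad.
have dyad1 : dyad (const_mx 1 : 'M[S]_n).
  exists (const_mx 1), (const_mx 1); apply/matrixP=> i j.
  by rewrite !mxE big_ord1 !mxE mulr1.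
have [|u [v T1]] := dyadT _ o o dyad1; first by rewrite mxE oner_eq0.
have col_s a b : collinear a b -> collinear (s a) (s b).
  move=> col_ab; pose A : 'M[S]_n := \matrix_(i, j) ((i, j) \in [:: a; b])%:R.
  have nzA x : (A x.1 x.2 != 0) = (x \in [:: a; b]).
    by rewrite mxE -surjective_pairing; case: (x \in _); rewrite ?oner_eq0 ?eqxx.
  have dyadA : dyad A.
    case: a b col_ab @A nzA => [a1 a2] [b1 b2] col_ab A nzA.
    exists (\col_i (i \in [:: a1; b1])%:R), (\row_j (j \in [:: a2; b2])%:R).
    apply/matrixP=> i j; rewrite !mxE big_ord1 !mxE !inE -natrM mulnb.
    rewrite -!pair_eqE /pair_eq /=; congr (nat_of_bool _)%:R.
    case/orP: col_ab => /= /eqP ->; rewrite ?orbb -?andb_orr -?andb_orl //.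
  (* Two cells on a line span a dyad; its image has exactly two nonzero entries,
     and these must fill a rectangle. *)
  have nzTA p : (T A p.1 p.2 != 0) = (p \in [:: s a; s b]).
    rewrite -(f_invF inj_s p) TE; set w := invF _ _.
    have -> : (s w \in [:: s a; s b]) = (w \in [:: a; b]).
      by rewrite !inE !(inj_eq inj_s).
    rewrite -nzA; apply/idP/idP; last exact: semifield_mulf_neq0.
    by apply: contraNN => /eqP->; rewrite mulr0.
  have dyadTA : dyad (T A).
    by apply: (dyadT _ a.1 a.2 dyadA); rewrite nzA mem_head.
  have : T A (s a).1 (s b).2 != 0.
    by apply: (@dyad_support _ _ (T A) _ (s a).2 (s b).1 _ sfS dyadTA);
      rewrite nzTA !inE eqxx ?orbT.
  rewrite (nzTA ((s a).1, (s b).2)) !inE -!pair_eqE /pair_eq /= !eqxx andbT /=.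
  by rewrite /collinear orbC [_ == (s a).2]eq_sym.
have [f [g [inj_f inj_g [sE | sE]]]] := collinear_perm_grid o inj_s col_s.
  have [||P [Q [invP invQ TPQ]]] := @weighted_grid_perm_mulmx _ _ T f g
    (fun i j => c (i, j)) u v sfS n_gt0 inj_f inj_g _ _ T1.
  - by move=> i j.
  - by move=> X i j; rewrite -(TE X (i, j)) sE.
  by exists P, Q; split=> //; left.
(* Here [s] exchanges rows and columns, so transposed images have the form above. *)
have [|||P [Q [[iP mP] [iQ mQ] TPQ]]] := @weighted_grid_perm_mulmx _ _
  (fun X => (T X)^T) f g (fun i j => c (i, j)) v^T u^T sfS n_gt0 inj_f inj_g.
- by move=> i j.
- by move=> X i j; rewrite mxE -(TE X (i, j)) sE.
- by rewrite T1 trmx_mul.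
exists Q^T, P^T; split; try by split; [apply: tr_invertible | apply: tr_monomial].
by right=> X; rewrite -[T X]trmxK TPQ !trmx_mul mulmxA.
Qed.

End Preserver.

Theorem theorem3p6 (S : comNzSemiRingType) (n : nat)
    (T : {linear 'M[S]_n -> 'M[S]_n}) :
  is_semifield S -> antinegative S -> (0 < n)%N -> bijective T ->
  [<-> preserves T (@green_D S n);
       preserves T (@green_J S n);
       preserves T (@green_leJ S n);
       exists P Q : 'M[S]_n,
         [/\ invertible_mx P /\ monomial_mx P,
             invertible_mx Q /\ monomial_mx Q
           & (forall X : 'M[S]_n, T X = P *m X *m Q) \/
             (forall X : 'M[S]_n, T X = P *m X^T *m Q)]].
Proof.
move=> sfS anS n_gt0 bijT.
have weak := weak_green_preserver sfS anS n_gt0 bijT.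
have leJ_tr (A B : 'M[S]_n) : green_leJ A B -> green_leJ A^T B^T.
  by case=> X [Y ->]; exists Y^T, X^T; rewrite !trmx_mul mulmxA.
have leJ_inv (P Q A B : 'M[S]_n) : invertible_mx P -> invertible_mx Q ->
    green_leJ A B -> green_leJ (P *m A *m Q) (P *m B *m Q).
  move=> [P' [_ P'P]] [Q' [QQ' _]] [X [Y ->]].
  exists (P *m X *m P'), (Q' *m Y *m Q); rewrite !mulmxA.
  rewrite -(mulmxA _ P' P) P'P mulmx1.
  by rewrite -(mulmxA _ Q Q') QQ' mulmx1.
have form_leJ : (exists P Q : 'M[S]_n,
    [/\ invertible_mx P /\ monomial_mx P, invertible_mx Q /\ monomial_mx Q
      & (forall X : 'M[S]_n, T X = P *m X *m Q) \/
        (forall X : 'M[S]_n, T X = P *m X^T *m Q)]) ->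
    preserves T (@green_leJ S n).
  case=> P [Q [[iP _] [iQ _] [TE | TE]]] A B leAB; rewrite !TE; apply: leJ_inv => //.
  exact: leJ_tr.
tfae.
- move=> presD A B [leAB leBA].
  have presJ : preserves T (@green_leJ S n).
    by apply/form_leJ/weak => {leAB leBA} A' B' /presD/green_D_J[].
  by split; apply: presJ.
- by move=> presJ; apply/form_leJ/weak => A B /green_D_J/presJ[].
- by move=> presJ; apply: weak => A B /green_D_J[/presJ].
- case=> P [Q [[iP _] [iQ _] [TE | TE]]] A B dAB; rewrite !TE.
    exact: green_D_invertible.
  by apply: green_D_invertible => //; apply: green_D_tr.
Qed.
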